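(* Let $M=(E,\mathcal{I})$ be a loopless matroid on a finite nonempty ground set $E$ with rank function $f$ and base family $\mathcal{B}$, with weights $\sigma\in\mathbb{R}^E_{>0}$, and let $m\in\mathbb{R}^E_{\ge 0}$ be the per-unit cost of increasing the elements. Let $\alpha=D_\sigma(M)$ be the fractional arboricity of $M$. Order $E=\{j_1,\dots,j_k\}$, $k=|E|$, so that $m(j_1)\le m(j_2)\le\dots\le m(j_k)$, and consider the following algorithm: start with $z=0\in\mathbb{R}^E$; for $i=1,2,\dots,k$ in turn, replace $$z(j_i)\ \leftarrow\ z(j_i)+\min\{\alpha f(A)-(\sigma+z)(A): j_i\in A\subseteq E\};$$ return $z$. Then after each iteration the matroid $M$ with the new weights $\sigma+z$ has unchanged fractional arboricity, i.e. $D_{\sigma+z}(M)=D_\sigma(M)$. When the algorithm terminates it outputs an optimal solution $z$ of the matroid reinforcement problem $$\text{minimize } m\cdot z\quad\text{subject to } z\in\mathbb{R}^E_{\ge 0},\ \sigma+z\in\operatorname{conic}(\mathcal{B}),$$ and the matroid $M$ with weights $\sigma+z$ is homogeneous.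
   Context: For $x\in\mathbb{R}^E$ and $A\subseteq E$ write $x(A)=\sum_{e\in A}x(e)$ and $m\cdot z=\sum_{e}m(e)z(e)$. For a matroid $M$ with rank function $r$ and weights $w\in\mathbb{R}^E_{\ge 0}$, the strength is $S_w(M)=\min\{w(X)/(r(E)-r(E-X)): X\subseteq E,\ r(E)>r(E-X)\}$ and the fractional arboricity is $D_w(M)=\max\{w(X)/r(X): X\subseteq E,\ r(X)>0\}$. $M$ with weights $w$ is homogeneous if $S_w(M)=D_w(M)$. Bases are identified with their incidence vectors in $\mathbb{R}^E$, and $\operatorname{conic}(\mathcal{B})=\bigcup_{h>0}h\,\mathrm{co}(\mathcal{B})$ denotes the conical hull of these vectors, where $\mathrm{co}$ is the convex hull. *)

(* Defs.v *)
From mathcomp Require Import all_boot all_order all_algebra.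
From mathcomp Require Import reals.

Set Implicit Arguments.
Unset Strict Implicit.
Unset Printing Implicit Defensive.

Import Order.TTheory GRing.Theory Num.Theory.
Local Open Scope ring_scope.

Record matroid (E : finType) := Matroid {
  indep : {set {set E}};
  indep0 : set0 \in indep;
  indep_sub : forall I J : {set E}, I \subset J -> J \in indep -> I \in indep;
  indep_aug : forall I J : {set E}, I \in indep -> J \in indep ->
    (#|I| < #|J|)%N -> exists2 e, e \in J :\: I & e |: I \in indep
}.

Definition rank (E : finType) (M : matroid E) (A : {set E}) : nat :=
  \max_(I in indep M | I \subset A) #|I|.

Definition bases (E : finType) (M : matroid E) : {set {set E}} :=
  [set B | maxset (mem (indep M)) B].

Definition loopless (E : finType) (M : matroid E) : Prop :=
  forall e : E, [set e] \in indep M.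

Definition wsum (R : realType) (E : finType) (x : {ffun E -> R})
  (A : {set E}) : R := \sum_(e in A) x e.

Definition dotp (R : realType) (E : finType) (m z : {ffun E -> R}) : R :=
  \sum_e m e * z e.

(* [min_value i0 P F] is the minimum of [F] over the finite set defined by [P],
   provided that [P i0] holds; likewise for [max_value]. *)
Definition min_value (R : realType) (I : finType) (i0 : I) (P : pred I)
  (F : I -> R) : R := F [arg min_(i < i0 | P i) F i]%O.

Definition max_value (R : realType) (I : finType) (i0 : I) (P : pred I)
  (F : I -> R) : R := F [arg max_(i > i0 | P i) F i]%O.

(* The admissible sets for the strength and for the fractional arboricity
   include [setT] exactly when the matroid has positive rank; a matroid of
   rank 0 gets junk values. *)
Definition strength (R : realType) (E : finType) (M : matroid E)
  (w : {ffun E -> R}) : R :=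
  min_value setT
    (fun X : {set E} => (rank M (~: X) < rank M setT)%N)
    (fun X : {set E} =>
       wsum w X / ((rank M setT)%:R - (rank M (~: X))%:R)).

Definition frac_arboricity (R : realType) (E : finType) (M : matroid E)
  (w : {ffun E -> R}) : R :=
  max_value setT
    (fun X : {set E} => (0 < rank M X)%N)
    (fun X : {set E} => wsum w X / (rank M X)%:R).

Definition homogeneous (R : realType) (E : finType) (M : matroid E)
  (w : {ffun E -> R}) : Prop := strength M w = frac_arboricity M w.

Definition incidence (R : realType) (E : finType) (A : {set E}) :
  {ffun E -> R} := [ffun e => (e \in A)%:R].

Definition in_co (R : realType) (E : finType) (F : {set {set E}})
  (x : {ffun E -> R}) : Prop :=
  exists c : {set E} -> R,
    [/\ forall B, B \in F -> 0 <= c B,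
        \sum_(B in F) c B = 1 &
        forall e, x e = \sum_(B in F) c B * incidence R B e].

(* The scaling factor is strictly positive, so 0 need not be in the hull. *)
Definition in_conic (R : realType) (E : finType) (F : {set {set E}})
  (x : {ffun E -> R}) : Prop :=
  exists2 h : R, 0 < h & exists2 y : {ffun E -> R},
    in_co F y & forall e, x e = h * y e.

Definition reinforcement_feasible (R : realType) (E : finType) (M : matroid E)
  (sigma z : {ffun E -> R}) : Prop :=
  (forall e, 0 <= z e) /\ in_conic (bases M) (sigma + z).

Definition reinforcement_optimal (R : realType) (E : finType) (M : matroid E)
  (sigma m z : {ffun E -> R}) : Prop :=
  reinforcement_feasible M sigma z /\
  forall z', reinforcement_feasible M sigma z' -> dotp m z <= dotp m z'.

Definition reinforce_step (R : realType) (E : finType) (M : matroid E)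
  (sigma : {ffun E -> R}) (alpha : R) (z : {ffun E -> R}) (j : E) :
  {ffun E -> R} :=
  let delta := min_value setT (fun A : {set E} => j \in A)
    (fun A : {set E} => alpha * (rank M A)%:R - wsum (sigma + z) A) in
  [ffun e => if e == j then z e + delta else z e].

(* The vector [z] after the elements of [s] have been processed in order. *)
Definition reinforce (R : realType) (E : finType) (M : matroid E)
  (sigma : {ffun E -> R}) (s : seq E) : {ffun E -> R} :=
  foldl (reinforce_step M sigma (frac_arboricity M sigma)) 0 s.

(* Main.v *)
Require Import Defs.
From mathcomp Require Import all_boot all_order all_algebra.
From mathcomp Require Import reals.
From mathcomp Require Import lra zify.

Import Order.TTheory GRing.Theory Num.Theory.
Local Open Scope ring_scope.

Set Implicit Arguments.
Unset Strict Implicit.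

(** Put alpha = D_sigma(M), and call a set A tight for x when x(A) = alpha f(A).
As M has no loops, the definition of D says that sigma(A) <= alpha f(A) for all
A, and that some nonempty set A0 is tight for sigma. A step of the algorithm
raises one coordinate as far as these inequalities allow: they survive, A0 stays
tight, so the fractional arboricity stays alpha, and the raised element ends up
in a tight set ([reinforce_stepP]). Since f is submodular, tight sets are closed under union
([tightUI]); hence after any number of steps one tight set U covers all the
processed elements, and at the end E itself is tight.

The bounds x(A) <= alpha f(A) together with x(E) = alpha f(E) give everything
else about the output x = sigma + z. Taking complements,
x(X) >= alpha (f(E) - f(E - X)), with equality for X = E, so the strength is alpha
as well and M with weights x is homogeneous. They also put x in the
conical hull of the bases, by Edmonds' description of the base polytope. That
is proved by peeling: some base B meets every tight set A in f(A) elements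
([tight_indep]), so subtracting a small multiple of B from x, and lowering alpha
by the same amount, keeps all tight sets tight; the largest admissible multiple
creates a new tight set, unless x is already a multiple of B ([co_bases_peel]).

For optimality, let z' be feasible, so that sigma + z' satisfies the same
constraints with some h in place of alpha; h >= alpha because of A0. Let U be
the tight set covering the first i elements processed. These elements already
account for z(U) = alpha f(U) - sigma(U), so the remaining ones receive
alpha (f(E) - f(U)) - sigma(E - U) in all, whereas z' must put at least
h (f(E) - f(U)) - sigma(E - U) on E - U ([wsum_tail_min]). Thus no feasible vector
puts less weight than z on a tail of the order; as the costs are nonnegative and sorted
increasingly, m.z is a nonnegative combination of these tail weights
([sum_sorted_ge0]). *)

(** * Matroid rank *)

Lemma rank_ge (E : finType) (M : matroid E) (I A : {set E}) :
  I \in indep M -> I \subset A -> (#|I| <= rank M A)%N.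
Proof.
by move=> iI sIA; rewrite /rank (bigmaxD1 I) ?iI ?leq_maxl //= iI.
Qed.

Lemma rank_indep_ex (E : finType) (M : matroid E) (A : {set E}) :
  exists I, [/\ I \in indep M, I \subset A & #|I| = rank M A].
Proof.
have card_gt0 : (0 < #|[pred I : {set E} | (I \in indep M) && (I \subset A)]|)%N.
  by apply/card_gt0P; exists set0; rewrite inE indep0 sub0set.
have [I] := eq_bigmax_cond (fun I : {set E} => #|I|) card_gt0.
by rewrite inE => /andP[iI sIA] eq_rk; exists I; split; rewrite // /rank eq_rk.
Qed.

Lemma rank0 (E : finType) (M : matroid E) : rank M set0 = 0%N.
Proof.
by have [I [_ + <-]] := rank_indep_ex M set0; rewrite subset0 => /eqP->; rewrite cards0.
Qed.

Lemma rank_gt0 (E : finType) (M : matroid E) (A : {set E}) :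
  loopless M -> A != set0 -> (0 < rank M A)%N.
Proof.
move=> M_loopless /set0Pn[e eA]; rewrite -(cards1 e).
by apply: rank_ge; rewrite ?sub1set //; apply: M_loopless.
Qed.

Lemma indep_extend (E : finType) (M : matroid E) (I A : {set E}) :
  I \in indep M -> I \subset A ->
  exists J, [/\ J \in indep M, I \subset J, J \subset A & #|J| = rank M A].
Proof.
move: {2}(_ - _)%N (leqnn (rank M A - #|I|)) => n.
elim: n I => [|n IHn] I le_n iI sIA.
  exists I; split=> //; apply/eqP; rewrite eqn_leq rank_ge //=.
  by rewrite -subn_eq0 -leqn0.
have [lt_rk|ge_rk] := ltnP #|I| (rank M A); last first.
  by exists I; split=> //; apply/eqP; rewrite eqn_leq ge_rk rank_ge.
have [K [iK sKA cK]] := rank_indep_ex M A.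
rewrite -cK in lt_rk; have [e] := indep_aug iI iK lt_rk.
rewrite inE => /andP[eI eK] iIe.
have [||J [iJ sIJ sJA cJ]] := IHn _ _ iIe.
- by rewrite cardsU1 eI; lia.
- by rewrite subUset sub1set (subsetP sKA).
exists J; split=> //; apply: subset_trans sIJ; exact: subsetUr.
Qed.

(** Extend a maximal independent subset of A :&: B to one of A :|: B, and count
its intersections with A and B. *)
Lemma rank_submodular (E : finType) (M : matroid E) (A B : {set E}) :
  (rank M (A :|: B) + rank M (A :&: B) <= rank M A + rank M B)%N.
Proof.
have [I [iI sI cI]] := rank_indep_ex M (A :&: B).
have sIU : I \subset A :|: B.
  by apply: subset_trans sI _; apply: subset_trans (subsetIl _ _) (subsetUl _ _).
have [J [iJ sIJ sJ <-]] := indep_extend iI sIU.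
have cap_le C : (#|J :&: C| <= rank M C)%N.
  apply: rank_ge; last exact: subsetIr.
  exact: indep_sub (subsetIl _ _) iJ.
have leI : (#|I| <= #|(J :&: A) :&: (J :&: B)|)%N.
  rewrite subset_leq_card // -setIIr subsetI sIJ //.
have := cardsUI (J :&: A) (J :&: B); rewrite -setIUr (setIidPl sJ) -cI.
by move: (cap_le A) (cap_le B); lia.
Qed.

Lemma basesP (E : finType) (M : matroid E) (B : {set E}) :
  reflect (B \in indep M /\ #|B| = rank M setT) (B \in bases M).
Proof.
rewrite inE; apply: (iffP maxsetP) => [[/= iB maxB]|[iB cB]]; split=> //.
  have [J [iJ sBJ _ cJ]] := indep_extend iB (subsetT B).
  by rewrite -cJ (maxB J).
move=> J iJ sBJ; apply/esym/eqP; rewrite eqEcard sBJ cB.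
by rewrite rank_ge.
Qed.

(** * Weights of sets *)

Section Weights.
Variables (R : realType) (E : finType).
Implicit Types (x y : {ffun E -> R}) (A B : {set E}).

Lemma wsumD x y A : wsum (x + y) A = wsum x A + wsum y A.
Proof. by rewrite /wsum -big_split; apply: eq_bigr => e _; rewrite ffunE. Qed.

Lemma wsum_ge0 x A : (forall e, 0 <= x e) -> 0 <= wsum x A.
Proof. by move=> x0; apply: sumr_ge0. Qed.

Lemma le_wsum x y A : (forall e, x e <= y e) -> wsum x A <= wsum y A.
Proof. by move=> le_xy; apply: ler_sum. Qed.

Lemma wsum0 x : wsum x set0 = 0.
Proof. by rewrite /wsum big_set0. Qed.

Lemma wsum1 x e : wsum x [set e] = x e.
Proof. by rewrite /wsum big_set1. Qed.

Lemma wsumID x A B : wsum x A = wsum x (A :&: B) + wsum x (A :\: B).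
Proof. exact: big_setID. Qed.

Lemma wsumC x A : wsum x setT = wsum x A + wsum x (~: A).
Proof. by rewrite (wsumID _ _ A) setTI setTD. Qed.

Lemma wsumUI x A B :
  wsum x (A :|: B) + wsum x (A :&: B) = wsum x A + wsum x B.
Proof.
rewrite (wsumID x (A :|: B) A) (wsumID x B A) setUK setDUl setDv set0U.
by rewrite (setIC B A) -addrA (addrC (wsum x (B :\: A))).
Qed.

Lemma wsum_subset x A B :
  (forall e, 0 <= x e) -> A \subset B -> wsum x A <= wsum x B.
Proof.
move=> x0 sAB; rewrite (wsumID x B A) (setIidPr sAB).
by rewrite lerDl wsum_ge0.
Qed.

Lemma wsum_incidence A B : wsum (incidence R B) A = #|B :&: A|%:R.
Proof.
rewrite -sum1_card natr_sum /wsum.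
rewrite [RHS](eq_bigl (fun e => (e \in A) && (e \in B))); last first.
  by move=> e; rewrite inE andbC.
rewrite big_mkcondr; apply: eq_bigr => e _; rewrite ffunE.
by case: (e \in B).
Qed.

Lemma wsum_seq x (s : seq E) : uniq s -> \sum_(e <- s) x e = wsum x [set e in s].
Proof.
by move=> us; rewrite big_uniq //; apply: eq_bigl => e; rewrite inE.
Qed.

End Weights.

Section Extrema.
Variables (R : realType) (I : finType) (i0 : I) (P : pred I) (F : I -> R).
Hypothesis Pi0 : P i0.

Lemma max_valueP :
  exists i, [/\ P i, max_value i0 P F = F i & forall j, P j -> F j <= F i].
Proof.
by rewrite /max_value; case: arg_maxP => // i Pi maxi; exists i.
Qed.

Lemma min_valueP :
  exists i, [/\ P i, min_value i0 P F = F i & forall j, P j -> F i <= F j].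
Proof.
by rewrite /min_value; case: arg_minP => // i Pi mini; exists i.
Qed.

Lemma max_value_eq (i1 : I) (v : R) :
  P i1 -> F i1 = v -> (forall i, P i -> F i <= v) -> max_value i0 P F = v.
Proof.
move=> Pi1 Fi1 leF; have [i [Pi -> maxi]] := max_valueP.
by apply/eqP; rewrite eq_le leF // -Fi1 maxi.
Qed.

Lemma min_value_eq (i1 : I) (v : R) :
  P i1 -> F i1 = v -> (forall i, P i -> v <= F i) -> min_value i0 P F = v.
Proof.
move=> Pi1 Fi1 leF; have [i [Pi -> mini]] := min_valueP.
by apply/eqP; rewrite eq_le leF // -Fi1 mini.
Qed.

End Extrema.

(** * Scaled base polytopes *)

Definition rank_bounded (R : realType) (E : finType) (M : matroid E) (a : R)
  (x : {ffun E -> R}) := forall A, wsum x A <= a * (rank M A)%:R.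

Definition tight (R : realType) (E : finType) (M : matroid E) (a : R)
  (x : {ffun E -> R}) (A : {set E}) := wsum x A == a * (rank M A)%:R.

Section Polytope.
Variables (R : realType) (E : finType) (M : matroid E).
Implicit Types (a : R) (x y : {ffun E -> R}) (A B : {set E}).

(** Submodularity squeezes all the inequalities for A :|: B and A :&: B into
equalities; in particular the rank is modular on tight sets. *)
Lemma tightUI a x A B : 0 <= a -> rank_bounded M a x ->
    tight M a x A -> tight M a x B ->
  [/\ tight M a x (A :|: B), tight M a x (A :&: B) &
      a * (rank M (A :|: B) + rank M (A :&: B))%:R = a * (rank M A + rank M B)%:R].
Proof.
move=> a0 bx /eqP tA /eqP tB.
have := wsumUI x A B; have := bx (A :|: B); have := bx (A :&: B).
have : a * (rank M (A :|: B) + rank M (A :&: B))%:R <= a * (rank M A + rank M B)%:R.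
  by rewrite ler_wpM2l // ler_nat rank_submodular.
rewrite tA tB !natrD !mulrDr => h1 h2 h3 h4.
by split; rewrite /tight; try (apply/eqP); lra.
Qed.

(** The case T = E provides a single base that is as large as possible on all
tight sets at once. The proof takes a maximal tight proper subset S of T and
extends the set obtained for S to a maximal independent subset of T. A tight
subset A of T outside S satisfies A :|: S = T by maximality, so the count for A
follows from those for S, T and A :&: S by modularity. *)
Lemma tight_indep a x (T : {set E}) : 0 < a -> rank_bounded M a x ->
    tight M a x T ->
  exists B, [/\ B \in indep M, B \subset T &
    forall A, A \subset T -> tight M a x A -> #|B :&: A| = rank M A].
Proof.
move=> a0 bx; move: {2}#|T|.+1 (ltnSn #|T|) => n.
elim: n T => // n IHn T leT tT.
have [->|T0] := eqVneq T set0.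
  exists set0; split; rewrite ?indep0 ?sub0set // => A.
  by rewrite subset0 => /eqP->; rewrite setI0 cards0 rank0.
have t0 : tight M a x set0 by rewrite /tight wsum0 rank0 mulr0.
have [|S /maxsetP[/= /andP[tS psS] maxS] _] :=
    @maxset_exists _ (fun S => tight M a x S && (S \proper T)) set0.
  by rewrite t0 properE sub0set subset0.
have sST := proper_sub psS.
have [|B0 [iB0 sB0 B0P]] := IHn S _ tS.
  by have := proper_card psS; lia.
have [B [iB sB0B sBT cB]] := indep_extend iB0 (subset_trans sB0 sST).
have BS : B :&: S = B0.
  apply/eqP; rewrite eq_sym eqEcard subsetI sB0B sB0 /=.
  rewrite -(setIidPl sB0) B0P //; apply: rank_ge (subsetIr _ _).
  exact: indep_sub (subsetIl _ _) iB.
have cBA A : A \subset S -> tight M a x A -> #|B :&: A| = rank M A.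
  by move=> sAS tA; rewrite -(B0P A) // -BS -setIA (setIidPr sAS).
exists B; split=> // A sAT tA.
have [tU tI] := tightUI (ltW a0) bx tA tS.
have [eqU|neU] := eqVneq (A :|: S) T; last first.
  move=> _; apply: cBA => //.
  rewrite -(maxS (A :|: S)) ?subsetUl ?subsetUr //.
  by rewrite tU properEneq neU subUset sAT sST.
move=> /(mulfI (lt0r_neq0 a0))/eqP; rewrite eqr_nat eqU => /eqP modular.
have := cardsUI (B :&: A) (B :&: S).
rewrite -setIUr -setIIr eqU (setIidPl sBT) cB !(cBA S) // (cBA (A :&: S)) ?subsetIr //.
by rewrite modular => /addIn.
Qed.

(** Edmonds' theorem: the rank inequalities, with equality on E, describe the
scaled hull of the bases. The induction is on the number of sets that are not tight. *)
Lemma co_bases_peel a x : 0 < a -> rank_bounded M a x -> tight M a x setT ->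
  exists c : {set E} -> R,
    [/\ forall B, 0 <= c B, \sum_(B in bases M) c B = a &
        forall e, x e = \sum_(B in bases M) c B * incidence R B e].
Proof.
move: {2}#|_|.+1 (ltnSn #|[pred A | ~~ tight M a x A]|) => n.
elim: n a x => // n IHn a x len a0 bx tT.
have [B [iB _ BP]] := tight_indep a0 bx tT.
have cB : #|B| = rank M setT by rewrite -[in LHS](setIT B) BP.
have bB : B \in bases M by apply/basesP.
have le_rank A : (#|B :&: A| <= rank M A)%N.
  by apply: rank_ge (subsetIr _ _); apply: indep_sub (subsetIl _ _) iB.
pose slack A := a * (rank M A)%:R - wsum x A.
pose deficit A : R := (rank M A)%:R - #|B :&: A|%:R.
have deficit0 A : 0 <= deficit A by rewrite subr_ge0 ler_nat.
have slack0 A : 0 <= slack A by rewrite subr_ge0.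
have peel_wsum (eps : R) A :
    wsum (x - [ffun e => eps * incidence R B e]) A = wsum x A - eps * #|B :&: A|%:R.
  rewrite -wsum_incidence /wsum mulr_sumr -sumrB.
  by apply: eq_bigr => e _; rewrite !ffunE.
(* A set A limits the multiple of B that can be removed to slack A / deficit A; if
   no such ratio is below a, then all of x can be removed. *)
have [A0 /andP[defA0 ltA0]|noA] :=
    pickP [pred A | (0 < deficit A) && (slack A / deficit A < a)]; last first.
  have le_x A : wsum x A <= a * #|B :&: A|%:R.
    have := noA A; rewrite /= lt0r deficit0 andbT; have [d0|dN0] /= := eqVneq (deficit A) 0.
      by move=> _; move: (slack0 A) d0; rewrite /slack /deficit; nra.
    have dp : 0 < deficit A by rewrite lt0r dN0 deficit0.
    move=> /negbT; rewrite -leNgt ler_pdivlMr // /slack /deficit mulrBr; lra.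
  (* equality holds in [le_x] for E, hence for complementary sets as well *)
  have x_eq e : x e = a * incidence R B e.
    have := le_x [set e]; have := le_x (~: [set e]).
    have := wsumC (incidence R B) [set e]; rewrite !wsum_incidence setIT => cardB.
    have := wsumC x [set e]; rewrite (eqP tT) -cB cardB mulrDr.
    by rewrite -(wsum1 x) -(wsum1 (incidence R B)) wsum_incidence; lra.
  exists (fun C => if C == B then a else 0); split=> [C||e].
  - by case: ifP => // _; apply: ltW.
  - rewrite -big_mkcondr (big_pred1 B) // => C /=.
    by case: eqP => [->|_]; rewrite ?andbF ?bB.
  - rewrite x_eq (bigD1 B) //= eqxx big1 ?addr0 // => C /andP[_ /negbTE->].
    by rewrite mul0r.
have PA0 : [pred A | 0 < deficit A] A0 by [].
case: (arg_minP (fun A => slack A / deficit A) PA0) => A1 /= defA1 minA1.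
set eps := slack A1 / deficit A1.
have eps_lt : eps < a by apply: le_lt_trans (minA1 _ _) ltA0.
have eps_ge0 : 0 <= eps by rewrite divr_ge0.
pose x' := x - [ffun e => eps * incidence R B e].
have slack_ge A : eps * deficit A <= slack A.
  have [dp|dn] := ltP 0 (deficit A); first by rewrite -ler_pdivlMr ?minA1.
  apply: le_trans (slack0 A); exact: mulr_ge0_le0.
have bx' : rank_bounded M (a - eps) x'.
  by move=> A; rewrite peel_wsum; have := slack_ge A; rewrite /slack /deficit; lra.
have tight_mono A : tight M a x A -> tight M (a - eps) x' A.
  move=> tA; rewrite /tight peel_wsum BP // ?subsetT //.
  by rewrite (eqP tA) mulrBl.
have ntA1 : ~~ tight M a x A1.
  apply/negP => tA1; move: defA1; rewrite /deficit BP ?subsetT //.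
  by rewrite subrr ltxx.
have tA1 : tight M (a - eps) x' A1.
  have : eps * deficit A1 = slack A1 by rewrite /eps divfK // lt0r_neq0.
  by rewrite /tight peel_wsum /slack /deficit => h; apply/eqP; lra.
have [||//||c [c0 sum_c x'E]] := IHn (a - eps) x'.
- rewrite ltnS in len; apply: leq_trans len; apply: proper_card.
  apply/properP; split; last by exists A1; rewrite inE /= ?ntA1 ?tA1.
  apply/subsetP => A; rewrite !inE; exact/contra/tight_mono.
- by rewrite subr_gt0.
- exact: tight_mono.
exists (fun C => c C + (if C == B then eps else 0)); split=> [C||e].
- by rewrite addr_ge0 //; case: ifP.
- rewrite big_split /= sum_c -big_mkcondr (big_pred1 B) ?subrK // => C /=.
  by case: eqP => [->|_]; rewrite ?andbF ?bB.
- have -> : x e = x' e + eps * incidence R B e by rewrite !ffunE subrK.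
  under [RHS]eq_bigr do rewrite mulrDl; rewrite big_split /= x'E; congr (_ + _).
  rewrite (bigD1 B) //= eqxx big1 ?addr0 // => C /andP[_ /negbTE->].
  by rewrite mul0r.
Qed.

Lemma tight_in_conic a x : 0 < a -> rank_bounded M a x -> tight M a x setT ->
  in_conic (bases M) x.
Proof.
move=> a0 bx tT; have [c [c0 sum_c xE]] := co_bases_peel a0 bx tT.
have aN0 := lt0r_neq0 a0.
exists a => //; exists [ffun e => a^-1 * x e]; last first.
  by move=> e; rewrite ffunE mulVKf.
exists (fun B => a^-1 * c B); split=> [B _||e].
- by rewrite mulr_ge0 // invr_ge0 ltW.
- by rewrite -mulr_sumr sum_c mulVf.
- by rewrite ffunE xE mulr_sumr; apply: eq_bigr => B _; rewrite mulrA.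
Qed.

Lemma co_bases_bounded y : in_co (bases M) y ->
  rank_bounded M 1 y /\ tight M 1 y setT.
Proof.
case=> c [c0 sum_c yE].
have wy A : wsum y A = \sum_(B in bases M) c B * #|B :&: A|%:R.
  under [RHS]eq_bigr do rewrite -wsum_incidence mulr_sumr.
  by rewrite exchange_big; apply: eq_bigr => e _; apply: yE.
split=> [A|]; rewrite /tight mul1r wy.
  rewrite -[leRHS]mul1r -[X in _ <= X * _]sum_c mulr_suml; apply: ler_sum => B bB.
  apply: ler_wpM2l; first exact: c0.
  rewrite ler_nat; case/basesP: bB => iB _.
  by apply: rank_ge (subsetIr _ _); apply: indep_sub (subsetIl _ _) iB.
rewrite -[X in _ == X]mul1r -[X in _ == X * _]sum_c mulr_suml; apply/eqP/eq_bigr => B.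
by case/basesP => _ cB; rewrite setIT cB.
Qed.

Lemma conic_bases_bounded x : in_conic (bases M) x ->
  exists h, rank_bounded M h x /\ tight M h x setT.
Proof.
case=> h h0 [y /co_bases_bounded[by_ /eqP ty] xE]; exists h.
have wx A : wsum x A = h * wsum y A.
  by rewrite mulr_sumr; apply: eq_bigr => e _; apply: xE.
split=> [A|]; rewrite /tight wx.
  by rewrite ler_wpM2l ?(ltW h0) //; have := by_ A; rewrite mul1r.
by rewrite ty mul1r.
Qed.

End Polytope.

(** * Strength and fractional arboricity *)

Section Density.
Variables (R : realType) (E : finType) (M : matroid E).
Hypotheses (M_loopless : loopless M) (E_nonempty : (0 < #|E|)%N).
Implicit Types (a : R) (w : {ffun E -> R}) (A : {set E}).

Lemma rankT_gt0 : (0 < rank M setT)%N.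
Proof. by apply: rank_gt0 => //; rewrite -card_gt0 cardsT. Qed.

Lemma frac_arboricity_eq a w A : rank_bounded M a w ->
  (0 < rank M A)%N -> tight M a w A -> frac_arboricity M w = a.
Proof.
move=> bw rA /eqP tA; apply: (max_value_eq _ (i1 := A)) => //; first exact: rankT_gt0.
  by rewrite tA mulfK // pnatr_eq0 -lt0n.
by move=> X rX; rewrite ler_pdivrMr ?ltr0n.
Qed.

Lemma frac_arboricityP w : exists X : {set E},
  [/\ (0 < rank M X)%N, frac_arboricity M w = wsum w X / (rank M X)%:R &
      forall A, (0 < rank M A)%N -> wsum w A / (rank M A)%:R <= frac_arboricity M w].
Proof.
rewrite /frac_arboricity.
have [X [rX -> maxX]] := max_valueP (P := fun X : {set E} => (0 < rank M X)%N)
  (fun X : {set E} => wsum w X / (rank M X)%:R) rankT_gt0.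
by exists X.
Qed.

Lemma frac_arboricity_bounded w : rank_bounded M (frac_arboricity M w) w.
Proof.
move=> A; have [->|/(rank_gt0 M_loopless) rA] := eqVneq A set0.
  by rewrite wsum0 rank0 mulr0.
have [_ [_ _ maxD]] := frac_arboricityP w.
by rewrite -ler_pdivrMr ?ltr0n ?maxD.
Qed.

Lemma frac_arboricity_tight w :
  exists2 A, (0 < rank M A)%N & tight M (frac_arboricity M w) w A.
Proof.
have [X [rX DX _]] := frac_arboricityP w.
by exists X => //; rewrite /tight DX divfK // pnatr_eq0 -lt0n.
Qed.

Lemma strength_eq a w : rank_bounded M a w -> tight M a w setT ->
  strength M w = a.
Proof.
move=> bw /eqP tT; have rT := rankT_gt0.
have rC : rank M (~: setT) = 0%N by rewrite setCT rank0.
apply: (min_value_eq _ (i1 := setT)) => [|||X ltX]; rewrite ?rC //.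
  by rewrite subr0 tT mulfK // pnatr_eq0 -lt0n.
rewrite ler_pdivlMr ?subr_gt0 ?ltr_nat // mulrBr.
by have := wsumC w X; have := bw (~: X); rewrite tT; lra.
Qed.

End Density.

(** * The greedy algorithm *)

Section Greedy.
Variables (R : realType) (E : finType) (M : matroid E) (sigma : {ffun E -> R}).
Hypotheses (alpha_ge0 : 0 <= frac_arboricity M sigma)
  (sigma_bounded : rank_bounded M (frac_arboricity M sigma) sigma).
Implicit Types (z : {ffun E -> R}) (s t : seq E) (A : {set E}).

Local Notation alpha := (frac_arboricity M sigma).

Lemma reinforce_rcons s e :
  reinforce M sigma (rcons s e) = reinforce_step M sigma alpha (reinforce M sigma s) e.
Proof. by rewrite /reinforce foldl_rcons. Qed.

(** Raising weights within the rank bounds cannot destroy a tight set. *)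
Lemma tight_mono z z' A : (forall e, z e <= z' e) ->
    rank_bounded M alpha (sigma + z') ->
  tight M alpha (sigma + z) A -> tight M alpha (sigma + z') A.
Proof.
move=> le_z bz' /eqP tA; rewrite /tight eq_le bz' -tA.
by rewrite !wsumD lerD2l le_wsum.
Qed.

Lemma reinforce_stepP z e (z' := reinforce_step M sigma alpha z e) :
    rank_bounded M alpha (sigma + z) ->
  [/\ rank_bounded M alpha (sigma + z'), forall e', z e' <= z' e',
      forall e', e' != e -> z' e' = z e' &
      exists2 A : {set E}, e \in A & tight M alpha (sigma + z') A].
Proof.
move=> bz; pose slack A := alpha * (rank M A)%:R - wsum (sigma + z) A.
have [A [eA deltaE minA]] :=
  min_valueP (P := fun A : {set E} => e \in A) slack (in_setT e).
set delta := min_value _ _ _ in deltaE.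
have z'E e' : z' e' = if e' == e then z e' + delta else z e' by rewrite ffunE.
have delta_ge0 : 0 <= delta by rewrite deltaE subr_ge0.
have wz' X : wsum (sigma + z') X = wsum (sigma + z) X + (e \in X)%:R * delta.
  rewrite !wsumD -addrA; congr (_ + _); have [eX|eNX] := boolP (e \in X).
    rewrite mul1r /wsum !(big_setD1 e eX) /= z'E eqxx addrAC; congr (_ + _ + _).
    by apply: eq_bigr => e'; rewrite !inE z'E => /andP[/negbTE->].
  rewrite mul0r addr0; apply: eq_bigr => e' e'X; rewrite z'E.
  by case: eqP e'X eNX => // -> ->.
split=> [X|e'|e' /negbTE Ne|].
- rewrite wz'; have [eX|eNX] := boolP (e \in X).
    by have := minA X eX; rewrite -deltaE /slack mul1r; lra.
  by rewrite mul0r addr0.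
- by rewrite z'E; case: eqP => // _; rewrite lerDl.
- by rewrite z'E Ne.
- by exists A => //; rewrite /tight wz' eA mul1r deltaE /slack addrC subrK.
Qed.

Lemma reinforce_bounded s : rank_bounded M alpha (sigma + reinforce M sigma s).
Proof.
elim/last_ind: s => [|s e IHs]; first by rewrite addr0.
by rewrite reinforce_rcons; case: (reinforce_stepP e IHs).
Qed.

Lemma reinforce_le_cat s t e :
  reinforce M sigma s e <= reinforce M sigma (s ++ t) e.
Proof.
elim/last_ind: t => [|t e' IHt]; first by rewrite cats0.
rewrite -rcons_cat reinforce_rcons; apply: le_trans IHt _.
by case: (reinforce_stepP e' (reinforce_bounded (s ++ t))).
Qed.

Lemma reinforce_ge0 s e : 0 <= reinforce M sigma s e.
Proof. by have := reinforce_le_cat [::] s e; rewrite ffunE. Qed.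

Lemma reinforce_notin s e : e \notin s -> reinforce M sigma s e = 0.
Proof.
elim/last_ind: s => [|s e' IHs]; first by rewrite ffunE.
rewrite mem_rcons inE negb_or => /andP[Ne /IHs <-]; rewrite reinforce_rcons.
by case: (reinforce_stepP e' (reinforce_bounded s)) => _ _ ->.
Qed.

Lemma reinforce_tight s :
  exists2 U : {set E}, {subset s <= U} & tight M alpha (sigma + reinforce M sigma s) U.
Proof.
elim/last_ind: s => [|s e [U sU tU]].
  by exists set0 => //; rewrite /tight wsum0 rank0 mulr0.
have bs := reinforce_bounded (rcons s e).
have [_ le_z _ [A eA tA]] := reinforce_stepP e (reinforce_bounded s).
rewrite -reinforce_rcons in le_z tA.
exists (U :|: A); last first.
  by case: (tightUI alpha_ge0 bs (tight_mono le_z bs tU) tA).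
move=> e'; rewrite mem_rcons !inE => /predU1P[->|/sU->//].
by rewrite eA orbT.
Qed.

Lemma reinforce_tightT s : (forall e, e \in s) ->
  tight M alpha (sigma + reinforce M sigma s) setT.
Proof.
move=> s_all; have [U sU] := reinforce_tight s.
by congr (tight _ _ _ _); apply/setP => e; rewrite inE sU.
Qed.

(** The greedy weight of the tail is exactly what the tight set U covering the
prefix leaves over, while U can carry at most h f(U) for a competitor. *)
Lemma wsum_tail_min s t h z : (forall e, e \in s ++ t) ->
    alpha <= h -> (forall e, 0 <= z e) ->
    rank_bounded M h (sigma + z) -> tight M h (sigma + z) setT ->
  wsum (reinforce M sigma (s ++ t)) (~: [set e in s]) <= wsum z (~: [set e in s]).
Proof.
move=> st_all le_h z_ge0 bz /eqP; set y := reinforce M sigma (s ++ t).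
have [U sU /eqP] := reinforce_tight s; set ys := reinforce M sigma s => tU.
have /eqP := reinforce_tightT st_all; rewrite -/y => tyT tzT.
have sTU : [set e in s] \subset U by apply/subsetP => e; rewrite inE => /sU.
have ysU : wsum ys U <= wsum y [set e in s].
  rewrite (wsumID _ U [set e in s]) (setIidPr sTU).
  rewrite [X in _ + X]big1 ?addr0 ?le_wsum //; first exact: reinforce_le_cat.
  by move=> e; rewrite !inE => /andP[/reinforce_notin].
have zU : wsum z (~: U) <= wsum z (~: [set e in s]).
  by apply: wsum_subset; rewrite ?setCS.
have bzU := bz U.
have le_rk : alpha * ((rank M setT)%:R - (rank M U)%:R) <=
    h * ((rank M setT)%:R - (rank M U)%:R).
  apply: ler_wpM2r => //; rewrite subr_ge0 ler_nat.
  have [I [iI _ <-]] := rank_indep_ex M U; exact: rank_ge.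
move: tU tyT tzT bzU; rewrite !wsumD.
have := wsumC z U; have := wsumC y [set e in s].
by move: le_rk; rewrite !mulrBr; lra.
Qed.

End Greedy.

(** * Optimality *)

(** Abel summation. The induction needs the stronger bound [lead], in which the
total of d is weighted by the smallest, that is the leading, value of m. *)
Lemma sum_sorted_ge0 (R : realType) (E : eqType) (m d : E -> R) (s : seq E) :
    (forall e, 0 <= m e) -> sorted (fun e e' => m e <= m e') s ->
    (forall i, 0 <= \sum_(e <- drop i s) d e) ->
  0 <= \sum_(e <- s) m e * d e.
Proof.
move=> m0 s_sorted d0.
suff lead e t : path (fun e e' => m e <= m e') e t ->
    (forall i, 0 <= \sum_(e' <- drop i (e :: t)) d e') ->
    m e * (\sum_(e' <- e :: t) d e') <= \sum_(e' <- e :: t) m e' * d e'.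
  case: s s_sorted d0 => [|e t] s_sorted d0; first by rewrite big_nil.
  by apply: le_trans (lead e t s_sorted d0); rewrite mulr_ge0 // (d0 0%N).
elim: t e => [|e' t IHt] e /=; first by rewrite !big_seq1.
move=> /andP[le_m pt] dt; rewrite [leRHS]big_cons [X in _ * X]big_cons mulrDr lerD2l.
have := IHt e' pt (fun i => dt i.+1); apply: le_trans.
by apply: ler_wpM2r => //; apply: (dt 1%N).
Qed.

Unset Implicit Arguments.
Set Strict Implicit.

Theorem theorem4p3 (R : realType) (E : finType) (M : matroid E)
    (sigma m : {ffun E -> R}) (s : seq E)
    (E_nonempty : (0 < #|E|)%N)
    (M_loopless : loopless M)
    (sigma_gt0 : forall e, 0 < sigma e)
    (m_ge0 : forall e, 0 <= m e)
    (s_enum : perm_eq s (enum E))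
    (s_sorted : sorted (fun e e' => m e <= m e') s) :
  [/\ forall i : nat, (1 <= i <= #|E|)%N ->
        frac_arboricity M (sigma + reinforce M sigma (take i s)) =
        frac_arboricity M sigma,
      reinforcement_optimal M sigma m (reinforce M sigma s) &
      homogeneous M (sigma + reinforce M sigma s)].
Proof.
set alpha := frac_arboricity M sigma; set z := reinforce M sigma s.
have s_all e : e \in s by rewrite (perm_mem s_enum) mem_enum.
have s_uniq : uniq s by rewrite (perm_uniq s_enum) enum_uniq.
have bsigma : rank_bounded M alpha sigma by apply: frac_arboricity_bounded.
have [A0 rA0 tA0] := frac_arboricity_tight M_loopless E_nonempty sigma.
have alpha_gt0 : 0 < alpha.
  have rT := rankT_gt0 M_loopless E_nonempty.
  rewrite -(pmulr_lgt0 _ (_ : 0 < (rank M setT)%:R)) ?ltr0n //.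
  apply: lt_le_trans (bsigma setT); have /card_gt0P[e _] := E_nonempty.
  apply: lt_le_trans (sigma_gt0 e) _; rewrite -wsum1 wsum_subset ?subsetT //.
  by move=> e'; apply: ltW.
have alpha_ge0 := ltW alpha_gt0.
have D_eq t : frac_arboricity M (sigma + reinforce M sigma t) = alpha.
  have bt := reinforce_bounded bsigma t.
  apply: (frac_arboricity_eq M_loopless E_nonempty (A := A0)) => //.
  apply: (tight_mono (z := 0)) bt _; last by rewrite addr0.
  by move=> e; rewrite ffunE; apply: reinforce_ge0.
have bz : rank_bounded M alpha (sigma + z) by apply: reinforce_bounded.
have tz : tight M alpha (sigma + z) setT by apply: reinforce_tightT.
split=> [i _||]; first exact: D_eq.
- split.
    split; first by move=> e; apply: reinforce_ge0.
    exact: tight_in_conic tz.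
  move=> z' [z'_ge0 /conic_bases_bounded[h [bz' tz']]].
  have le_h : alpha <= h.
    rewrite -(ler_pM2r (_ : 0 < (rank M A0)%:R)) ?ltr0n // -(eqP tA0).
    by apply: le_trans (bz' A0); rewrite wsumD lerDl wsum_ge0.
  rewrite -subr_ge0 /dotp -sumrB.
  under eq_bigr do rewrite -mulrBr.
  rewrite -big_enum -(perm_big _ s_enum) /=.
  apply: sum_sorted_ge0 => // i; rewrite sumrB subr_ge0.
  have tailE (x : {ffun E -> R}) :
      \sum_(e <- drop i s) x e = wsum x (~: [set e in take i s]).
    rewrite wsum_seq ?drop_uniq //; congr (wsum _ _); apply/setP => e; rewrite !inE.
    move: (s_all e) s_uniq; rewrite -{1 2}(cat_take_drop i s) mem_cat cat_uniq.
    case: (boolP (e \in take i s)) => //= e_take _ /and3P[_ /hasPn disj _].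
    by apply/negP => /disj /=; rewrite e_take.
  rewrite !tailE.
  have := wsum_tail_min alpha_ge0 bsigma
    (s := take i s) (t := drop i s) _ le_h z'_ge0 bz' tz'.
  by rewrite cat_take_drop; apply.
- by rewrite /homogeneous (strength_eq M_loopless E_nonempty bz) ?D_eq.
Qed.
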